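(* Let $m\ge 1$ and let $\{P_0,\dots,P_m\}$ be a symmetric Clifford system on $\mathbb{R}^{2l}$ with $l-m-1\ge 1$, and set $(m_+,m_-)=(m,\,l-m-1)$. Then the positive semidefinite quartic form $$G_F(x)=|x|^4-\sum_{\alpha=0}^m\langle P_\alpha x,x\rangle^2,\qquad x\in\mathbb{R}^{2l},$$ is a sum of squares of real polynomials if and only if one of the following holds: $m=1$; $m=2$; $(m_+,m_-)=(5,2)$; $(m_+,m_-)=(6,1)$; $(m_+,m_-)=(3,4)$; or $(m_+,m_-)=(4,3)$ and the Clifford system is of the indefinite class.
   Context: A symmetric Clifford system on $\mathbb{R}^{2l}$ is a family of real symmetric $2l\times 2l$ matrices $P_0,\dots,P_m$ with $P_\alpha P_\beta+P_\beta P_\alpha=2\delta_{\alpha\beta}I_{2l}$ for all $\alpha,\beta$. The associated isoparametric polynomial of OT-FKM type is $F(x)=|x|^4-2\sum_{\alpha=0}^m\langle P_\alpha x,x\rangle^2$, with multiplicities $(m_+,m_-)=(m,l-m-1)$, both positive, and $G_F=\frac12(|x|^4+F)$. For $m\equiv 0\pmod 4$ the system is called definite if $P_0P_1\cdots P_m=\pm I_{2l}$, and indefinite otherwise. A form is a homogeneous real polynomial; it is positive semidefinite if it is nonnegative on all of $\mathbb{R}^{2l}$, and it is a sum of squares (sos) if it equals $\sum_j h_j^2$ for finitely many real polynomials $h_j$. *)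

(* Defs.v *)
From HB Require Import structures.
From mathcomp Require Import all_boot all_order all_algebra.
From mathcomp Require Import reals.
From mathcomp Require Import mpoly.

Set Implicit Arguments.
Unset Strict Implicit.
Unset Printing Implicit Defensive.

Import Order.TTheory GRing.Theory Num.Theory.
Local Open Scope ring_scope.

Definition clifford_system (R : realType) (l m : nat)
    (P : 'I_m.+1 -> 'M[R]_(2 * l)) : Prop :=
  (forall a, (P a)^T = P a) /\
  (forall a b, P a *m P b + P b *m P a = (2 * (a == b)%:R)%:M).

Definition multiplicities (l m : nat) : nat * nat := (m, (l - m - 1)%N).

(* The product P_0 P_1 ... P_m, in this order. *)
Definition clifford_prod (R : realType) (l m : nat)
    (P : 'I_m.+1 -> 'M[R]_(2 * l)) : 'M[R]_(2 * l) :=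
  \big[mulmx/1%:M]_(a < m.+1) P a.

(* The definite/indefinite dichotomy only makes sense for m = 0 mod 4. *)
Definition definite (R : realType) (l m : nat)
    (P : 'I_m.+1 -> 'M[R]_(2 * l)) : Prop :=
  (4 %| m)%N /\ (clifford_prod P = 1%:M \/ clifford_prod P = - 1%:M).

Definition indefinite (R : realType) (l m : nat)
    (P : 'I_m.+1 -> 'M[R]_(2 * l)) : Prop :=
  (4 %| m)%N /\ ~ definite P.

(* |x|^2 and <A x, x>, as polynomials in the coordinates of x. *)
Definition sqnorm_poly (R : realType) (n : nat) : {mpoly R[n]} :=
  \sum_(i < n) 'X_i ^+ 2.

Definition quad_poly (R : realType) (n : nat) (A : 'M[R]_n) : {mpoly R[n]} :=
  \sum_(i < n) (\sum_(j < n) A i j *: 'X_j) * 'X_i.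

Definition FKM_poly (R : realType) (l m : nat)
    (P : 'I_m.+1 -> 'M[R]_(2 * l)) : {mpoly R[2 * l]} :=
  sqnorm_poly R (2 * l) ^+ 2 - 2 *: \sum_(a < m.+1) quad_poly (P a) ^+ 2.

Definition GF (R : realType) (l m : nat)
    (P : 'I_m.+1 -> 'M[R]_(2 * l)) : {mpoly R[2 * l]} :=
  2^-1 *: (sqnorm_poly R (2 * l) ^+ 2 + FKM_poly P).

Definition psd (R : realType) (n : nat) (p : {mpoly R[n]}) : Prop :=
  forall x : 'I_n -> R, 0 <= p.@[x].

Definition sos (R : realType) (n : nat) (p : {mpoly R[n]}) : Prop :=
  exists hs : seq {mpoly R[n]}, p = \sum_(h <- hs) h ^+ 2.

Lemma GF_E (R : realType) (l m : nat) (P : 'I_m.+1 -> 'M[R]_(2 * l)) :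
  GF P = sqnorm_poly R (2 * l) ^+ 2 - \sum_(a < m.+1) quad_poly (P a) ^+ 2.
Proof.
rewrite /GF /FKM_poly addrA -mulr2n -scaler_nat -scalerBr scalerA.
by rewrite mulVf ?scale1r // pnatr_eq0.
Qed.

Lemma sqnorm_polyE (R : realType) (n : nat) (x : 'cV[R]_n) :
  (sqnorm_poly R n).@[x ^~ ord0] = (x^T *m x) ord0 ord0.
Proof.
rewrite /sqnorm_poly raddf_sum mxE; apply: eq_bigr => i _ /=.
by rewrite expr2 mevalM mevalXU mxE.
Qed.

Lemma quad_polyE (R : realType) (n : nat) (A : 'M[R]_n) (x : 'cV[R]_n) :
  (quad_poly A).@[x ^~ ord0] = ((A *m x)^T *m x) ord0 ord0.
Proof.
rewrite /quad_poly raddf_sum mxE; apply: eq_bigr => i _ /=.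
rewrite mevalM mevalXU !mxE raddf_sum; congr (_ * _).
by apply: eq_bigr => j _ /=; rewrite mevalZ mevalXU.
Qed.

(* Main.v *)
(* Write N = 2l, and let T = P_0 P_1 P_2 P_3 when m >= 3.

   Necessity. If G_F is the sum of the h^2, the h vanish to second order at 0,
   and fourth derivatives at 0 turn the identity into one between
   symmetrizations of A (x) A, for A half the Hessian of h. Contracting it with
   B (x) B for B = 1 + P_a and B = 1 - P_a shows that each A anticommutes with
   each P_a; contracting with B = T and with B = 1 and subtracting gives
     sum_A tr(A T)^2 = N (16 - N) - sum_(a > 3) tr(P_a T)^2.
   So l <= 8, and P_1 P_2, P_1 P_3 make the range of the projection
   (1 + P_0) / 2, of dimension l, a module over the quaternions, so 4 | l and
   l = 8. If m >= 4 then P_4 anticommutes with A T, so the left-hand side is 0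
   and tr(P_4 T) = 0, which excludes the definite systems with m = 4.

   Sufficiency. Let Pi be the orthogonal projection of x x^T onto the matrices
   anticommuting with P_0, ..., P_k: it is an alternating average over products
   P_S of the (P_S x) (P_S x)^T. In |Pi|^2 only the symmetric P_S survive, so
   that 2^(k+1) |Pi|^2 is G_F for k = m = 1 and k = m = 2, and it is
   |x|^4 - sum_(a <= 3) <P_a x, x>^2 + <T x, x>^2 for k = 3. When N = 16, T and
   the P_a with a > 3 are orthogonal members of squared norm 16 in the range of
   the projection, and removing their components from Pi leaves G_F / 16. *)
Require Import Defs.
From mathcomp Require Import all_boot all_order all_algebra.
From mathcomp Require Import reals.
From mathcomp Require Import mpoly zify ring.

Import Order.TTheory GRing.Theory Num.Theory.
Local Open Scope ring_scope.

(** * Anticommuting matrices and traces *)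

Section Anticommutation.
Context {S : comPzRingType} {n : nat}.
Implicit Types A B C : 'M[S]_n.

Definition anti_mx A B := A *m B = - (B *m A).

Lemma anti_mx_sym A B : anti_mx A B -> anti_mx B A.
Proof. by rewrite /anti_mx => ->; rewrite opprK. Qed.

Lemma comm_mxaa A B C : anti_mx A B -> anti_mx A C -> comm_mx A (B *m C).
Proof.
rewrite /anti_mx /comm_mx => AB AC.
by rewrite mulmxA AB mulNmx -(mulmxA B A) AC mulmxN opprK mulmxA.
Qed.

Lemma anti_mxac A B C : anti_mx A B -> comm_mx A C -> anti_mx A (B *m C).
Proof.
rewrite /anti_mx /comm_mx => AB AC.
by rewrite mulmxA AB mulNmx -(mulmxA B A) AC mulmxA.
Qed.

Lemma anti_mxca A B C : comm_mx A B -> anti_mx A C -> anti_mx A (B *m C).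
Proof.
rewrite /anti_mx /comm_mx => AB AC.
by rewrite mulmxA AB -(mulmxA B A) AC mulmxN mulmxA.
Qed.

Lemma conj_anti_mx A B : A *m A = 1%:M -> anti_mx A B -> A *m B *m A = - B.
Proof.
move=> AA AB; rewrite -mulmxA (anti_mx_sym _ _ AB) mulmxN mulmxA AA.
by rewrite mul1mx.
Qed.

End Anticommutation.

(** Conjugation by the involution [A] preserves the trace and sends [B] to [- B]. *)
Lemma mxtrace_anti (S : numDomainType) (n : nat) (A B : 'M[S]_n) :
  A *m A = 1%:M -> anti_mx A B -> \tr B = 0.
Proof.
move=> AA AB; have := conj_anti_mx _ _ AA AB; move/(congr1 mxtrace).
rewrite mxtrace_mulC mulmxA AA mul1mx raddfN /= => /eqP.
by rewrite -addr_eq0 -mulr2n mulrn_eq0 => /eqP.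
Qed.

Lemma mxtrace_tr_mul (S : comPzRingType) (m n : nat) (M : 'M[S]_(m, n)) :
  \tr (M^T *m M) = \sum_i \sum_j M i j ^+ 2.
Proof.
rewrite exchange_big; apply: eq_bigr => j _; rewrite mxE.
by apply: eq_bigr => i _; rewrite mxE expr2.
Qed.

Lemma mxtrace_tr_mul_ge0 (S : realDomainType) (m n : nat) (M : 'M[S]_(m, n)) :
  0 <= \tr (M^T *m M).
Proof.
by rewrite mxtrace_tr_mul; do 2!apply: sumr_ge0 => ? _; rewrite sqr_ge0.
Qed.

Lemma mxtrace_tr_mul_eq0 (S : realDomainType) (m n : nat) (M : 'M[S]_(m, n)) :
  \tr (M^T *m M) = 0 -> M = 0.
Proof.
rewrite mxtrace_tr_mul => M0; apply/matrixP => i j; rewrite mxE.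
have := psumr_eq0P (fun i _ => sumr_ge0 _ (fun j _ => sqr_ge0 (M i j))) M0.
move=> /(_ i isT) /(psumr_eq0P (fun j _ => sqr_ge0 (M i j))) /(_ j isT).
by move/eqP; rewrite sqrf_eq0 => /eqP.
Qed.

(** In the full-rank factorization of an idempotent, the two factors multiply in the opposite order
    to the identity of size [\rank e]. *)
Lemma mxtrace_idempotent (F : fieldType) (n : nat) (e : 'M[F]_n) :
  e *m e = e -> \tr e = (\rank e)%:R.
Proof.
move=> ee; have bc : row_base e *m col_base e = 1%:M.
  apply: (row_free_inj (row_base_free e)); apply: (row_full_inj (col_base_full e)).
  by rewrite mul1mx -mulmxA !mulmx_base mulmxA mulmx_base ee.
by rewrite -{1}(mulmx_base e) mxtrace_mulC bc mxtrace1.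
Qed.

(** * Quaternionic modules *)

Lemma quaternion_stable_mx (F : realFieldType) (n : nat) (J1 J2 : 'M[F]_n) :
    J1 *m J1 = - 1%:M -> J2 *m J2 = - 1%:M -> anti_mx J1 J2 ->
  forall k, (4 * k < n + 4)%N ->
  exists W : 'M_n,
    [/\ (W *m J1 <= W)%MS, (W *m J2 <= W)%MS & \rank W = (4 * k)%N].
Proof.
move=> J11 J22 J12; elim=> [|k IHk] ltkn.
  by exists 0; rewrite !mul0mx sub0mx mxrank0.
have [|W [WJ1 WJ2 rW]] := IHk; first by lia.
(* The bound on [k.+1] says exactly that [W], of rank [4 * k], is still proper. A vector outside [W]
   and its images under the quaternion units will add four dimensions. *)
have ltWn : (\rank W < n)%N by rewrite rW -(ltn_add2r 4) -mulnSr.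
have [v vW] : exists v : 'rV_n, ~~ (v <= W)%MS.
  have /row_subPn[i rowi] : ~~ (1%:M <= W)%MS.
    by rewrite sub1mx -[row_full _]/(_ == _) neq_ltn ltWn.
  by exists (row i 1%:M).
pose U := \matrix_(i < 4) nth 0 [:: v; v *m J1; v *m J2; v *m J1 *m J2] i.
have J21 : v *m J2 *m J1 = - (v *m J1 *m J2).
  by rewrite -!mulmxA J12 mulmxN opprK.
have J121 : v *m J1 *m J2 *m J1 = v *m J2.
  rewrite -mulmxA (anti_mx_sym _ _ J12) mulmxN -!mulmxA (mulmxA J1) J11.
  by rewrite mulNmx !mulmxN mul1mx opprK.
have vJ1J1 : v *m J1 *m J1 = - v by rewrite -mulmxA J11 mulmxN mulmx1.
have vJ2J2 w : w *m J2 *m J2 = - w :> 'rV_n by rewrite -mulmxA J22 mulmxN mulmx1.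
have subU (c : 'rV_4) : c *m U =
    c 0 0 *: v + c 0 1 *: (v *m J1) + c 0 2%:R *: (v *m J2) + c 0 3%:R *: (v *m J1 *m J2).
  rewrite mulmx_sum_row !big_ord_recr big_ord0 /= add0r !rowK /=.
  by congr (_ + _ + _ + _); congr (c _ _ *: _); apply: val_inj.
have indep (c : 'rV_4) : (c *m U <= W)%MS -> c = 0.
  move=> cUW; have cUW1 := submx_trans (submxMr J1 cUW) WJ1.
  have cUW2 := submx_trans (submxMr J2 cUW) WJ2.
  have cUW3 := submx_trans (submxMr J2 cUW1) WJ2.
  pose s := \sum_i c 0 i ^+ 2.
  have sE : s = c 0 0 ^+ 2 + c 0 1 ^+ 2 + c 0 2%:R ^+ 2 + c 0 3%:R ^+ 2.
    rewrite /s !big_ord_recr big_ord0 /= add0r.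
    by congr (_ + _ + _ + _); congr (c _ _ ^+ 2); apply: val_inj.
  (* Here [c *m U] is a quaternion acting on [v]; acting further by the conjugate quaternion gives
     the norm [s] times [v]. *)
  have sv : s *: v = c 0 0 *: (c *m U) - c 0 1 *: (c *m U *m J1)
      - c 0 2%:R *: (c *m U *m J2) - c 0 3%:R *: (c *m U *m J1 *m J2).
    rewrite subU !mulmxDl -!scalemxAl !(J121, J21, vJ1J1, vJ2J2).
    rewrite sE !mulNmx !vJ2J2.
    move: (c 0 0) (c 0 1) (c 0 2%:R) (c 0 3%:R) => c0 c1 c2 c3.
    by apply/rowP => j; rewrite !mxE; ring.
  have svW : (s *: v <= W)%MS.
    by rewrite sv !addmx_sub // ?eqmx_opp scalemx_sub.
  have s0 : s = 0.
    apply/eqP; apply: contraNT vW => s0.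
    by rewrite -(scale1r v) -(mulVf s0) -scalerA scalemx_sub.
  apply/rowP => i; rewrite mxE; apply/eqP; rewrite -sqrf_eq0; apply/eqP.
  exact: (psumr_eq0P (fun i _ => sqr_ge0 (c 0 i)) s0).
have rU : \rank U = 4.
  apply/eqP; rewrite -[_ == _]/(row_free U) -kermx_eq0; apply/rowV0P => c.
  by move/sub_kermxP => cU0; apply: indep; rewrite cU0 sub0mx.
have rowU (i : 'I_4) w :
    w = nth 0 [:: v; v *m J1; v *m J2; v *m J1 *m J2] i -> (w <= U)%MS.
  by move=> ->; rewrite -(rowK (fun i : 'I_4 => nth 0 _ i) i) row_sub.
have [U0 U1 U2 U3] := And4 (rowU 0 _ erefl) (rowU 1 _ erefl)
  (rowU 2%:R _ erefl) (rowU 3%:R _ erefl).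
exists (W + U)%MS; split.
- rewrite addsmxMr addsmxS //; apply/row_subP => i; rewrite row_mul rowK.
  by case: i => [[|[|[|[|]]]]] //= _; rewrite ?vJ1J1 ?J21 ?J121 ?eqmx_opp.
- rewrite addsmxMr addsmxS //; apply/row_subP => i; rewrite row_mul rowK.
  by case: i => [[|[|[|[|]]]]] //= _; rewrite ?vJ2J2 ?eqmx_opp.
rewrite mxrank_disjoint_sum ?rW ?rU ?mulnSr //; apply/eqP/rowV0P => u.
rewrite sub_capmx => /andP[uW /submxP[c uE]]; move: uW.
by rewrite uE => /indep ->; rewrite mul0mx.
Qed.

(** If 4 did not divide [n], the growth of stable subspaces could go on to [k = n %/ 4 + 1], where
    the rank exceeds [n]. *)
Lemma dvdn4_quaternion_mx (F : realFieldType) (n : nat) (J1 J2 : 'M[F]_n) :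
    J1 *m J1 = - 1%:M -> J2 *m J2 = - 1%:M -> anti_mx J1 J2 ->
  (4 %| n)%N.
Proof.
move=> J11 J22 J12; apply: contraT => n4.
have lt4n : (4 * (n %/ 4).+1 < n + 4)%N.
  by rewrite mulnS addnC ltn_add2r mulnC ltn_neqAle -dvdn_eq n4 leq_divM.
have [W [_ _ rW]] := quaternion_stable_mx _ _ _ _ J11 J22 J12 _ lt4n.
have := rank_leq_col W; rewrite rW leqNgt mulnC.
by rewrite ltn_ceil.
Qed.

(* Compress the quaternion action to the image of [e]. *)
Lemma dvdn4_rank_quaternion (F : realFieldType) (n : nat) (e J1 J2 : 'M[F]_n) :
    comm_mx e J1 -> comm_mx e J2 ->
    J1 *m J1 = - 1%:M -> J2 *m J2 = - 1%:M -> anti_mx J1 J2 ->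
  (4 %| \rank e)%N.
Proof.
move=> eJ1 eJ2 J11 J22 J12; pose W := row_base e.
(* The row space of [e] is stable under [J], so [W *m J *m pinvmx W] is the matrix of [J] in the
   basis [W]. *)
have stab J : comm_mx e J -> W *m J *m pinvmx W *m W = W *m J.
  move=> eJ; rewrite mulmxKpV // eq_row_base.
  have We : (W <= e)%MS by rewrite eq_row_base.
  by rewrite (submx_trans (submxMr J We)) // eJ submxMl.
have [WJ1 WJ2] := (stab _ eJ1, stab _ eJ2).
apply: (@dvdn4_quaternion_mx _ _ (W *m J1 *m pinvmx W) (W *m J2 *m pinvmx W));
  rewrite ?/anti_mx; apply: (row_free_inj (row_base_free e)).
- by rewrite -(mulmxA _ _ W) WJ1 mulmxA WJ1 -mulmxA J11 mulmxN mulNmx mulmx1 mul1mx.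
- by rewrite -(mulmxA _ _ W) WJ2 mulmxA WJ2 -mulmxA J22 mulmxN mulNmx mulmx1 mul1mx.
rewrite -[row_base e]/W mulNmx -(mulmxA _ _ W) WJ2 -(mulmxA _ _ W) WJ1.
by rewrite mulmxA WJ1 [in RHS]mulmxA WJ2 -!(mulmxA W) J12 mulmxN.
Qed.

(** * Second-order jets at the origin *)

Section Jet.
Context {R : realType} {n : nat}.
Implicit Types (p h : {mpoly R[n]}) (A B : 'M[R]_n).

Lemma mderiv_sum (I : Type) (r : seq I) (F : I -> {mpoly R[n]}) i :
  (\sum_(x <- r) F x)^`M(i) = \sum_(x <- r) (F x)^`M(i).
Proof. exact: (raddf_sum (mderiv i)). Qed.

Lemma meval_sum (I : Type) (r : seq I) (F : I -> {mpoly R[n]}) v :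
  (\sum_(x <- r) F x).@[v] = \sum_(x <- r) (F x).@[v].
Proof. exact: (raddf_sum (meval v)). Qed.

Definition hess0 p : 'M[R]_n := \matrix_(i, j) p^`M(i)^`M(j).@[fun=> 0].

Lemma hess0_sym p : (hess0 p)^T = hess0 p.
Proof. by apply/matrixP => i j; rewrite !mxE mderiv_comm. Qed.

Definition flat0 p := p.@[fun=> 0] = 0 /\ forall i, p^`M(i).@[fun=> 0] = 0.

(** For symmetric [A], three times the average of A (x) A over all permutations of the four
    indices. *)
Definition sym4 A (i j k l : 'I_n) :=
  A i j * A k l + A i k * A j l + A i l * A j k.

(** In the Leibniz expansion only the splittings with two derivatives on each factor survive at a
    flat point, and each of the three pairings of the indices occurs twice. *)
Lemma mderiv4_sqr h i j k l : flat0 h ->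
  (h ^+ 2)^`M(i)^`M(j)^`M(k)^`M(l).@[fun=> 0] = 2 * sym4 (hess0 h) i j k l.
Proof.
move=> [h0 h1]; rewrite expr2 !(mderivM, mderivD) !(mevalD, mevalM) !h1 h0.
by rewrite /sym4 !mxE; ring.
Qed.

(** Squares summing to zero at 0 make every [h] vanish there. The second derivative of [h ^+ 2] is
    then twice a square, and the same argument gives the first derivatives. *)
Lemma sqr_sum_flat0 (hs : seq {mpoly R[n]}) :
  flat0 (\sum_(h <- hs) h ^+ 2) ->
  (forall i, (\sum_(h <- hs) h ^+ 2)^`M(i)^`M(i).@[fun=> 0] = 0) ->
  forall h, h \in hs -> flat0 h.
Proof.
move=> [s0 _] s2.
have h0 h : h \in hs -> h.@[fun=> 0] = 0.
  move=> hhs; move: s0; rewrite raddf_sum /= => /eqP.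
  rewrite psumr_eq0 => [|g _]; last by rewrite rmorphXn sqr_ge0.
  by move=> /allP/(_ h hhs); rewrite /= rmorphXn sqrf_eq0 => /eqP.
move=> h hhs; split=> [|i]; first exact: h0.
have d2 g : g \in hs -> (g ^+ 2)^`M(i)^`M(i).@[fun=> 0] = 2 * g^`M(i).@[fun=> 0] ^+ 2.
  move=> /h0 g0; rewrite expr2 !(mderivM, mderivD) !(mevalD, mevalM) g0; ring.
have := s2 i; rewrite !(mderiv_sum _ hs) (meval_sum _ hs) big_seq.
under eq_bigr => g ghs do rewrite d2 //.
rewrite -big_seq => /eqP.
rewrite psumr_eq0 => [|g _]; last first.
  by rewrite mulr_ge0 ?sqr_ge0.
by move=> /allP/(_ h hhs); rewrite /= mulf_eq0 pnatr_eq0 sqrf_eq0 => /eqP.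
Qed.

Lemma sqnorm_quad : sqnorm_poly R n = quad_poly 1%:M.
Proof.
apply: eq_bigr => i _; rewrite expr2; congr (_ * _).
rewrite (bigD1 i) //= big1 => [|j ji]; rewrite !mxE ?eqxx ?scale1r ?addr0 //.
by rewrite eq_sym (negPf ji) scale0r.
Qed.


Lemma mderiv_X (i j : 'I_n) : 'X_j^`M(i) = (i == j)%:R :> {mpoly R[n]}.
Proof.
rewrite mderivX mnm1E eq_sym; case: eqP => [->|_]; last by rewrite scale0r.
by rewrite scale1r -{1}[U_(j)%MM]addm0 addmC addmK mpolyX0.
Qed.

Lemma mderiv_quad A i :
  (quad_poly A)^`M(i) = \sum_j (A i j + A j i) *: 'X_j.
Proof.
rewrite /quad_poly mderiv_sum.
under eq_bigr do rewrite mderivM mderiv_sum mderiv_X.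
rewrite big_split /= addrC; under [RHS]eq_bigr do rewrite scalerDl.
rewrite big_split /=; congr (_ + _).
  rewrite [LHS](bigD1 i) //= [X in _ + X]big1 ?addr0 => [|j ji].
    by rewrite eqxx mulr1.
  by rewrite eq_sym (negPf ji) mulr0.
apply: eq_bigr => j _; rewrite (bigD1 i) //= big1 ?addr0 => [|k ki].
  by rewrite mderivZ mderiv_X eqxx -scalerAl mul1r.
by rewrite mderivZ mderiv_X eq_sym (negPf ki) scaler0.
Qed.

Lemma quad_flat0 A : flat0 (quad_poly A).
Proof.
split=> [|i]; rewrite ?mderiv_quad meval_sum big1 // => j _ /=.
  by rewrite mevalM mevalXU mulr0.
by rewrite mevalZ mevalXU mulr0.
Qed.

Lemma hess0_quad A : hess0 (quad_poly A) = A + A^T.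
Proof.
apply/matrixP => i j; rewrite !mxE mderiv_quad mderiv_sum meval_sum (bigD1 j) //=.
rewrite big1 => [|k kj]; rewrite mderivZ mderiv_X mevalZ.
  by rewrite eqxx meval1 mulr1 addr0.
by rewrite eq_sym (negPf kj) meval0 mulr0.
Qed.
End Jet.

(** * The tensor identity behind a quartic sum of squares *)

Section SosGram.
Context {R : realType} {n : nat}.
Implicit Types A B : 'M[R]_n.

(* The contraction of the full symmetrization of [A (x) A] with [B (x) B]. *)
Definition biquad A B := \tr (A *m B) ^+ 2 + 2 * \tr (A *m B *m (A *m B)).

(** The pairing (ij)(kl) gives the squared trace. The other two both give the trace of ABAB, since
    the symmetry of [B] allows [k] and [l] to be swapped. *)
Lemma biquadE A B : A^T = A -> B^T = B ->
  biquad A B = \sum_i \sum_j \sum_k \sum_l B i j * B k l * sym4 A i j k l.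
Proof.
move=> At Bt; have As i j : A i j = A j i by rewrite -{1}At mxE.
have Bs i j : B i j = B j i by rewrite -{1}Bt mxE.
have trAB : \tr (A *m B) = \sum_i \sum_j B i j * A i j.
  apply: eq_bigr => i _; rewrite mxE; apply: eq_bigr => j _.
  by rewrite mulrC Bs.
have tr4 : \tr (A *m B *m (A *m B)) =
    \sum_i \sum_j \sum_k \sum_l B i j * B k l * (A i l * A j k).
  have -> : \tr (A *m B *m (A *m B)) = \tr (B *m A *m (B *m A)).
    by rewrite -mulmxA mxtrace_mulC !mulmxA.
  transitivity (\sum_i \sum_k (\sum_j B i j * A j k) * (\sum_l B k l * A l i)).
    by apply: eq_bigr => i _; rewrite mxE; apply: eq_bigr => k _; rewrite !mxE.
  apply: eq_bigr => i _; rewrite exchange_big /=; apply: eq_bigr => k _.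
  rewrite mulr_suml; apply: eq_bigr => j _; rewrite mulr_sumr.
  by apply: eq_bigr => l _; rewrite (As l i); ring.
have tr4' : \sum_i \sum_j \sum_k \sum_l B i j * B k l * (A i k * A j l) =
    \sum_i \sum_j \sum_k \sum_l B i j * B k l * (A i l * A j k).
  apply: eq_bigr => i _; apply: eq_bigr => j _; rewrite exchange_big /=.
  by apply: eq_bigr => k _; apply: eq_bigr => l _; rewrite (Bs k l).
have tr2 : \tr (A *m B) ^+ 2 =
    \sum_i \sum_j \sum_k \sum_l B i j * B k l * (A i j * A k l).
  rewrite expr2 trAB mulr_suml; apply: eq_bigr => i _.
  rewrite mulr_suml; apply: eq_bigr => j _.
  rewrite mulr_sumr; apply: eq_bigr => k _.
  by rewrite mulr_sumr; apply: eq_bigr => l _; ring.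
rewrite /biquad mulr_natl mulr2n {1}tr4 -tr4' tr4 tr2 addrA -big_split /= -big_split.
apply: eq_bigr => i _; rewrite -!big_split; apply: eq_bigr => j _.
rewrite -!big_split; apply: eq_bigr => k _; rewrite -!big_split.
by apply: eq_bigr => l _; rewrite /sym4 /=; ring.
Qed.

Lemma sum_contract (T : Type) (r : seq T) (w : 'I_n -> 'I_n -> 'I_n -> 'I_n -> R)
    (f : T -> 'I_n -> 'I_n -> 'I_n -> 'I_n -> R) :
  \sum_(x <- r) \sum_i \sum_j \sum_k \sum_l w i j k l * f x i j k l =
  \sum_i \sum_j \sum_k \sum_l w i j k l * \sum_(x <- r) f x i j k l.
Proof.
rewrite exchange_big; apply: eq_bigr => i _.
rewrite exchange_big; apply: eq_bigr => j _.
rewrite exchange_big; apply: eq_bigr => k _.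
rewrite exchange_big; apply: eq_bigr => l _.
by rewrite mulr_sumr.
Qed.

(** The matrices are half the Hessians at 0 of the squared polynomials, which need not be quadratic
    forms: fourth derivatives at 0 see nothing else of them. *)
Lemma sos_quartic_gram (I : finType) (Q : I -> 'M[R]_n) :
    (forall a, (Q a)^T = Q a) ->
    sos (quad_poly 1%:M ^+ 2 - \sum_a quad_poly (Q a) ^+ 2) ->
  exists2 As : seq 'M[R]_n, (forall A, A \in As -> A^T = A) &
    forall B, B^T = B ->
    \sum_(A <- As) biquad A B = biquad 1%:M B - \sum_a biquad (Q a) B.
Proof.
move=> Qt [hs pE]; set p := (X in X = _) in pE.
have sym1 : (1%:M : 'M[R]_n)^T = 1%:M by rewrite trmx1.
have hess_half A : A^T = A -> hess0 (quad_poly A) = 2 *: A.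
  by move=> At; rewrite hess0_quad At scaler_nat mulr2n.
have p_flat : flat0 p.
  have q0 A := (quad_flat0 A).1; have q1 A := (quad_flat0 A).2.
  rewrite /p; split=> [|i].
    rewrite mevalB (meval_sum _ (index_enum I)) expr2 mevalM q0 mul0r sub0r.
    rewrite big1 ?oppr0 // => a _.
    by rewrite expr2 mevalM q0 mul0r.
  rewrite mderivB mevalB (mderiv_sum _ (index_enum I)) (meval_sum _ (index_enum I)).
  rewrite expr2 mderivM mevalD !mevalM q0 mulr0 mul0r add0r sub0r.
  rewrite big1 ?oppr0 // => a _.
  by rewrite expr2 mderivM mevalD !mevalM q0 mulr0 mul0r add0r.
have p_flat2 i : p^`M(i)^`M(i).@[fun=> 0] = 0.
  have q2 A : (quad_poly A ^+ 2)^`M(i)^`M(i).@[fun=> 0] = 0.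
    have [q0 q1] := quad_flat0 A.
    by rewrite expr2 !(mderivM, mderivD) !(mevalD, mevalM) q0 q1 !(mulr0, mul0r, addr0).
  rewrite /p 2!mderivB mevalB !(mderiv_sum _ (index_enum I)) (meval_sum _ (index_enum I)).
  by rewrite q2 sub0r big1 ?oppr0.
have hs_flat h : h \in hs -> flat0 h.
  by apply: sqr_sum_flat0; rewrite -pE.
pose half A := 2^-1 *: A : 'M[R]_n.
have halfK A : A = 2 *: half A.
  by rewrite /half scalerA mulfV ?scale1r // pnatr_eq0.
have sym4Z c A i j k l : sym4 (c *: A) i j k l = c ^+ 2 * sym4 A i j k l.
  by rewrite /sym4 !mxE; ring.
have gram i j k l : \sum_(h <- hs) sym4 (half (hess0 h)) i j k l =
    sym4 1%:M i j k l - \sum_a sym4 (Q a) i j k l.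
  have := congr1 (fun q => q^`M(i)^`M(j)^`M(k)^`M(l).@[fun=> 0]) pE.
  rewrite /= /p 4!mderivB mevalB.
  rewrite !(mderiv_sum _ (index_enum I)) !(mderiv_sum _ hs).
  rewrite (meval_sum _ (index_enum I)) (meval_sum _ hs).
  rewrite mderiv4_sqr; last exact: quad_flat0.
  under [X in _ - X = _ -> _]eq_bigr => a _ do
    rewrite (mderiv4_sqr _ _ _ _ _ (quad_flat0 _)) hess_half // sym4Z.
  rewrite hess_half // sym4Z [RHS]big_seq.
  under [RHS]eq_bigr => h hhs do
    rewrite (mderiv4_sqr _ _ _ _ _ (hs_flat _ hhs)) (halfK (hess0 h)) sym4Z.
  rewrite -big_seq -!mulr_sumr => E.
  (* The factor 2 comes from [mderiv4_sqr], and [2 ^+ 2] from each Hessian being twice its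
     matrix. *)
  have c_neq0 : (2 * 2 ^+ 2 : R) != 0 by rewrite mulf_neq0 ?expf_neq0 ?pnatr_eq0.
  by apply: (mulfI c_neq0); rewrite -[LHS]mulrA -E; ring.
exists [seq half (hess0 h) | h <- hs] => [_ /mapP[h _ ->]|B Bt].
  by rewrite linearZ /= hess0_sym.
rewrite big_map; under [LHS]eq_bigr => h _ do rewrite biquadE ?linearZ //= ?hess0_sym //.
under [X in _ = _ - X]eq_bigr => a _ do rewrite biquadE //.
rewrite biquadE //.
rewrite !sum_contract -sumrB; apply: eq_bigr => i _.
rewrite -sumrB; apply: eq_bigr => j _; rewrite -sumrB; apply: eq_bigr => k _.
by rewrite -sumrB; apply: eq_bigr => l _; rewrite gram mulrBr.
Qed.
End SosGram.

(** * Clifford families *)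

Definition clifford_family {I : finType} {S : comPzRingType} {n : nat}
    (Q : I -> 'M[S]_n) :=
  [/\ forall a, (Q a)^T = Q a, forall a, Q a *m Q a = 1%:M
    & forall a b, a != b -> anti_mx (Q a) (Q b)].

Lemma clifford_system_family {R : realType} {l m : nat}
    {P : 'I_m.+1 -> 'M[R]_(2 * l)} :
  clifford_system P -> clifford_family P.
Proof.
move=> [Pt PP]; split=> [//|a|a b ab].
  have := PP a a; rewrite eqxx mulr1 -mulr2n -scaler_nat => /(congr1 ( *:%R 2^-1)).
  by rewrite scalerA mulVf ?pnatr_eq0 // scale1r scale_scalar_mx mulVf ?pnatr_eq0.
have := PP a b; rewrite (negPf ab) mulr0 raddf0 => /eqP.
by rewrite addr_eq0 => /eqP.
Qed.

(** * Members of the Gram family anticommute with the Clifford family *)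

Section Gram.
Context {R : realType} {n : nat}.
Implicit Types A U : 'M[R]_n.

(** As [E] is twice an orthogonal projection, four times the trace of AEAE is the squared norm of
    [E *m A *m E]. *)
Lemma involution_quarter U A : U^T = U -> U *m U = 1%:M -> A^T = A ->
  let E := 1%:M + U in
  0 <= biquad A E /\ (biquad A E = 0 -> E *m A *m E = 0).
Proof.
move=> Ut UU At E.
have Et : E^T = E by rewrite raddfD /= trmx1 Ut.
have EE : E *m E = 2 *: E.
  by rewrite mulmxDl mul1mx mulmxDr mulmx1 UU (addrC U) scaler_nat mulr2n.
have trE : \tr ((E *m A *m E)^T *m (E *m A *m E)) = 4 * \tr (A *m E *m (A *m E)).
  rewrite !trmx_mul At Et !mulmxA mxtrace_mulC !mulmxA EE.
  rewrite -!scalemxAl -(mulmxA _ E E) EE -scalemxAr -!scalemxAl !linearZ /=.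
  by rewrite mulrA -natrM mxtrace_mulC !mulmxA.
have tr_ge0 : 0 <= \tr (A *m E *m (A *m E)).
  by rewrite -(pmulr_rge0 _ (ltr0n R 4)) -trE mxtrace_tr_mul_ge0.
split; first by rewrite addr_ge0 ?sqr_ge0 ?mulr_ge0.
move=> /eqP; rewrite paddr_eq0 ?sqr_ge0 ?mulr_ge0 // => /andP[_].
rewrite mulf_eq0 pnatr_eq0 /= => /eqP tr0; apply: mxtrace_tr_mul_eq0.
by rewrite trE tr0 mulr0.
Qed.

(** The hypotheses kill the two diagonal blocks of [A] for the eigenspaces of [U]; their difference
    is twice [U *m A + A *m U]. *)
Lemma anti_of_quarters U A : U *m U = 1%:M ->
  (1%:M + U) *m A *m (1%:M + U) = 0 -> (1%:M - U) *m A *m (1%:M - U) = 0 ->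
  anti_mx U A.
Proof.
move=> UU; rewrite !(mulmxDl, mulmxDr) !(mul1mx, mulmx1, mulNmx, mulmxN) opprK.
move=> E1 E2.
have E3 : 2 *: (U *m A + A *m U) = 0.
  rewrite -[RHS]subr0 -{1}E1 -E2 scaler_nat mulr2n; apply/matrixP => i j.
  by rewrite !mxE; ring.
move/eqP: E3; rewrite scaler_eq0 pnatr_eq0 /= addr_eq0 => /eqP //.
Qed.

(** With [E] the test matrix, [Q a *m E = s *: E], so the term of [Q a] cancels that of the
    identity. For other [b], both [E *m Q b *m E] and the trace of [Q b *m E] vanish. *)
Lemma biquad_clifford_quarter (I : finType) (Q : I -> 'M[R]_n) (a : I) (s : R) :
  clifford_family Q -> s ^+ 2 = 1 ->
  biquad 1%:M (1%:M + s *: Q a) - \sum_b biquad (Q b) (1%:M + s *: Q a) = 0.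
Proof.
move=> [Qt QQ Qa] s1; set U := s *: Q a; set E := 1%:M + U.
have UU : U *m U = 1%:M.
  by rewrite -scalemxAl -scalemxAr scalerA -expr2 s1 scale1r QQ.
have UE : Q a *m E = s *: E.
  rewrite mulmxDr mulmx1 -scalemxAr QQ scalerDr scalerA -expr2 s1 scale1r.
  by rewrite addrC.
rewrite (bigD1 a) //= big1 ?addr0 => [|b ba].
  rewrite /biquad mul1mx UE -scalemxAl -scalemxAr scalerA !linearZ /=.
  by rewrite -expr2 s1 mul1r exprMn s1 mul1r subrr.
have ab : anti_mx (Q a) (Q b) by apply: Qa; rewrite eq_sym.
have bE : E *m (Q b *m E) = 0.
  have -> : E *m (Q b *m E) = Q b *m ((1%:M - U) *m E).
    rewrite !mulmxA; congr (_ *m _); rewrite mulmxBr mulmxDl mulmx1 mul1mx.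
    by rewrite -scalemxAl ab scalerN scalemxAr.
  rewrite mulmxBl mul1mx [U *m E]mulmxDr mulmx1 UU (addrC U).
  by rewrite subrr mulmx0.
rewrite /biquad -mulmxA bE mulmx0 raddf0 mulr0 addr0.
rewrite mulmxDr mulmx1 -scalemxAr linearD linearZ /=.
rewrite (mxtrace_anti _ _ _ _ (QQ a) ab) add0r.
rewrite (mxtrace_anti _ _ (Q a) (Q b *m Q a)) ?mulr0 ?expr0n //.
exact: anti_mxac.
Qed.

(** Tested on [1%:M + Q a] and on [1%:M - Q a], the identity makes a sum of nonnegative terms
    vanish, so each term vanishes. *)
Lemma gram_anti_clifford (I : finType) (Q : I -> 'M[R]_n) (As : seq 'M[R]_n) :
    clifford_family Q -> (forall A, A \in As -> A^T = A) ->
    (forall B, B^T = B -> \sum_(A <- As) biquad A B =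
       biquad 1%:M B - \sum_a biquad (Q a) B) ->
  forall A a, A \in As -> anti_mx (Q a) A.
Proof.
move=> cQ Ast gram A a AAs; have [Qt QQ _] := cQ.
have quarter s : s ^+ 2 = 1 ->
    (1%:M + s *: Q a) *m A *m (1%:M + s *: Q a) = 0.
  move=> s1.
  have Ut : (s *: Q a)^T = s *: Q a by rewrite linearZ /= Qt.
  have UU : (s *: Q a) *m (s *: Q a) = 1%:M.
    by rewrite -scalemxAl -scalemxAr scalerA -expr2 s1 scale1r QQ.
  have [_] := involution_quarter _ _ Ut UU (Ast _ AAs); apply.
  have := gram (1%:M + s *: Q a); rewrite biquad_clifford_quarter //.
  rewrite raddfD /= trmx1 Ut => /(_ erefl)/eqP.
  rewrite big_seq psumr_eq0 => [/allP/(_ A AAs)|B /Ast Bt].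
    by rewrite AAs => /eqP.
  by have [] := involution_quarter _ _ Ut UU Bt.
apply: anti_of_quarters => //.
  by have := quarter 1; rewrite expr1n scale1r; apply.
by have := quarter (-1); rewrite sqrrN expr1n scaleN1r; apply.
Qed.

End Gram.

Lemma trmx_anti_mul {S : comPzRingType} {n : nat} (A B : 'M[S]_n) :
  A^T = A -> B^T = B -> anti_mx A B -> (A *m B)^T = - (A *m B).
Proof. by move=> At Bt AB; rewrite trmx_mul At Bt AB opprK. Qed.

Lemma mulmx_anti_sqr {S : comPzRingType} {n : nat} (A B : 'M[S]_n) :
    A *m A = 1%:M -> B *m B = 1%:M -> anti_mx A B ->
  A *m B *m (A *m B) = - 1%:M.
Proof.
move=> AA BB AB; rewrite {1}AB mulNmx -mulmxA (mulmxA A A) AA mul1mx.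
by rewrite BB.
Qed.

Lemma uniq4_neq {X : eqType} {a b c d : X} : uniq [:: a; b; c; d] ->
  [/\ a != b, a != c, a != d & [/\ b != c, b != d & c != d]].
Proof.
rewrite /= !inE !negb_or andbT.
by move=> /and3P[/and3P[-> -> ->] /andP[-> ->] ->].
Qed.

(** * The product of four generators *)

Section Volume.
Context {I : finType} {S : comPzRingType} {n : nat}.
Context {Q : I -> 'M[S]_n} (cQ : clifford_family Q).
Context {q0 q1 q2 q3 : I}.
Context (q_uniq : uniq [:: q0; q1; q2; q3]).

(** The grouping exhibits two commuting skew factors of square -1, when the indices are distinct;
    the transpose and the square are computed from these pairs. *)
Definition volume4 := Q q0 *m Q q1 *m (Q q2 *m Q q3).

Let Qt a : (Q a)^T = Q a. Proof. by case: cQ. Qed.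
Let QQ a : Q a *m Q a = 1%:M. Proof. by case: cQ. Qed.
Let Qanti a b : a != b -> anti_mx (Q a) (Q b). Proof. by case: cQ => _ _; apply. Qed.

Lemma volume4_comm_pairs :
  comm_mx (Q q0 *m Q q1) (Q q2 *m Q q3).
Proof.
have [n01 n02 n03 [n12 n13 n23]] := uniq4_neq q_uniq.
have c0 : comm_mx (Q q0) (Q q2 *m Q q3) by apply: comm_mxaa; apply: Qanti.
have c1 : comm_mx (Q q1) (Q q2 *m Q q3) by apply: comm_mxaa; apply: Qanti.
by apply: comm_mx_sym; apply: comm_mxM; apply: comm_mx_sym.
Qed.

Lemma volume4_tr : volume4^T = volume4.
Proof.
have [n01 _ _ [_ _ n23]] := uniq4_neq q_uniq.
rewrite trmx_mul !trmx_anti_mul //; try exact: Qanti.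
by rewrite mulNmx mulmxN opprK -volume4_comm_pairs.
Qed.

Lemma volume4_sqr : volume4 *m volume4 = 1%:M.
Proof.
have [n01 _ _ [_ _ n23]] := uniq4_neq q_uniq.
rewrite /volume4 {1}volume4_comm_pairs -mulmxA (mulmxA (Q q0 *m Q q1)).
rewrite (mulmx_anti_sqr (Q q0)) ?mulNmx ?mul1mx ?mulmxN ?mulmx_anti_sqr ?opprK //;
  exact: Qanti.
Qed.

Lemma volume4_anti_in a : a \in [:: q0; q1; q2; q3] -> anti_mx (Q a) volume4.
Proof.
have [n01 n02 n03 [n12 n13 n23]] := uniq4_neq q_uniq.
have Qanti' a' b : b != a' -> anti_mx (Q a') (Q b) by rewrite eq_sym; apply: Qanti.
rewrite !inE => /or4P[] /eqP->.
- exact: anti_mxac (anti_mxca _ _ _ erefl (Qanti _ _ _))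
    (comm_mxaa _ _ _ (Qanti _ _ _) (Qanti _ _ _)).
- exact: anti_mxac (anti_mxac _ _ _ (Qanti' _ _ _) erefl)
    (comm_mxaa _ _ _ (Qanti _ _ _) (Qanti _ _ _)).
- exact: anti_mxca (comm_mxaa _ _ _ (Qanti' _ _ _) (Qanti' _ _ _))
    (anti_mxca _ _ _ erefl (Qanti _ _ _)).
- exact: anti_mxca (comm_mxaa _ _ _ (Qanti' _ _ _) (Qanti' _ _ _))
    (anti_mxac _ _ _ (Qanti' _ _ _) erefl).
Qed.

Lemma volume4_comm (B : 'M_n) :
  (forall a, a \in [:: q0; q1; q2; q3] -> anti_mx B (Q a)) ->
  comm_mx B volume4.
Proof.
by move=> BQ; apply: comm_mxM; apply: comm_mxaa; apply: BQ; rewrite !inE eqxx ?orbT.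
Qed.

Lemma volume4_comm_notin a : a \notin [:: q0; q1; q2; q3] -> comm_mx (Q a) volume4.
Proof.
move=> aq; apply: volume4_comm => b bq; apply: Qanti.
by apply: contraNneq aq => ->.
Qed.

End Volume.
Arguments volume4 {I S n} Q q0 q1 q2 q3.

(** * The Gram identity contracted with the volume element *)

Section VolumeGram.
Context {R : realType} {n : nat} {I : finType}.
Context {Q : I -> 'M[R]_n} (cQ : clifford_family Q).
Context {q0 q1 q2 q3 : I}.
Context (q_uniq : uniq [:: q0; q1; q2; q3]).
Let T := volume4 Q q0 q1 q2 q3.

Lemma mxtrace_mul_anti (A B : 'M[R]_n) : anti_mx A B -> \tr (A *m B) = 0.
Proof.
move=> AB; have := congr1 mxtrace AB; rewrite raddfN /= mxtrace_mulC => /eqP.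
by rewrite -addr_eq0 -mulr2n mulrn_eq0 mxtrace_mulC => /eqP.
Qed.

Lemma mxtrace_clifford a : \tr (Q a) = 0.
Proof.
have [_ QQ Qa] := cQ; have [b ba] : exists b, b != a.
  have [->|] := eqVneq a q0; last by exists q0; rewrite eq_sym.
  by exists q1; move: q_uniq; rewrite /= !inE !negb_or eq_sym => /andP[/andP[]].
exact: (mxtrace_anti _ _ _ _ (QQ b) (Qa _ _ ba)).
Qed.

(** The identity for [T] minus the identity for [1%:M]. Each [A] has trace zero and commutes with
    [T], so on the left only the squared traces remain. On the right the identity matrix contributes
    [- n ^ 2], each of the four generators in [T] contributes [4 n], and each other generator minus
    a squared trace. *)
Lemma gram_volume4 (As : seq 'M[R]_n) :
    (forall A, A \in As -> A^T = A) ->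
    (forall B, B^T = B -> \sum_(A <- As) biquad A B =
       biquad 1%:M B - \sum_a biquad (Q a) B) ->
  \sum_(A <- As) \tr (A *m T) ^+ 2 =
    n%:R * (16 - n%:R) - \sum_(a | a \notin [:: q0; q1; q2; q3]) \tr (Q a *m T) ^+ 2.
Proof.
move=> Ast gram; have antiA := gram_anti_clifford _ _ _ cQ Ast gram.
have [Qt QQ Qa] := cQ.
have TT : T *m T = 1%:M by apply: volume4_sqr.
have Tt : T^T = T by apply: volume4_tr.
have sq_comm B : comm_mx B T -> B *m T *m (B *m T) = B *m B.
  by move=> BT; rewrite {2}BT mulmxA -(mulmxA B) TT mulmx1.
have biq1 B : \tr B = 0 -> biquad B 1%:M = 2 * \tr (B *m B).
  by move=> trB; rewrite /biquad mulmx1 trB expr0n add0r.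
have biqT B : comm_mx B T -> \tr B = 0 ->
    \tr (B *m T) ^+ 2 = biquad B T - biquad B 1%:M.
  by move=> BT trB; rewrite biq1 // /biquad sq_comm // addrK.
have T0 : \tr T = 0.
  by apply: (mxtrace_anti _ _ _ _ (QQ q0)); apply: volume4_anti_in; rewrite ?inE ?eqxx.
have biq_in a : a \in [:: q0; q1; q2; q3] ->
    biquad (Q a) 1%:M - biquad (Q a) T = 4 * n%:R.
  move=> aq; have aT : anti_mx (Q a) T by exact: volume4_anti_in.
  rewrite biq1 ?mxtrace_clifford // /biquad (mxtrace_mul_anti _ _ aT).
  by rewrite mulmx_anti_sqr // QQ raddfN /= mxtrace1; ring.
have biq_out a : a \notin [:: q0; q1; q2; q3] ->
    biquad (Q a) 1%:M - biquad (Q a) T = - \tr (Q a *m T) ^+ 2.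
  by move=> aq; rewrite biqT ?opprB ?mxtrace_clifford //; exact: volume4_comm_notin.
have -> : \sum_(A <- As) \tr (A *m T) ^+ 2 =
    \sum_(A <- As) biquad A T - \sum_(A <- As) biquad A 1%:M.
  rewrite -sumrB !big_seq; apply: eq_bigr => A AAs.
  rewrite biqT //; last exact: (mxtrace_anti _ _ _ _ (QQ q0) (antiA _ _ AAs)).
  by apply: volume4_comm => a _; apply/anti_mx_sym/antiA.
rewrite !gram ?trmx1 //.
have sub4 (x y z t : R) : x - y - (z - t) = x - z + (t - y) by ring.
rewrite sub4 -sumrB (bigID [pred a | a \in [:: q0; q1; q2; q3]]) /=.
rewrite (eq_bigr _ biq_in) (eq_bigr _ biq_out).
rewrite sumr_const (card_uniqP q_uniq) sumrN /biquad !mul1mx TT T0 !mxtrace1.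
by rewrite -mulr_natl /=; ring.
Qed.
End VolumeGram.

(** * Divisibility of dimensions and traces *)

Section Ranks.
Context {R : realType} {n : nat} {I : finType}.
Context {Q : I -> 'M[R]_n} (cQ : clifford_family Q).
Context {q0 q1 q2 q3 : I}.
Context (q_uniq : uniq [:: q0; q1; q2; q3]).

Let QQ a : Q a *m Q a = 1%:M. Proof. by case: cQ. Qed.
Let Qanti a b : a != b -> anti_mx (Q a) (Q b). Proof. by case: cQ => _ _; apply. Qed.

(* [Q q1 *m Q q2] and [Q q1 *m Q q3] generate a copy of the quaternions. *)
Lemma clifford_idempotent_trace (e : 'M[R]_n) :
    e *m e = e -> comm_mx e (Q q1 *m Q q2) -> comm_mx e (Q q1 *m Q q3) ->
  exists k : nat, \tr e = (4 * k)%:R.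
Proof.
have [_ _ _ [n12 n13 n23]] := uniq4_neq q_uniq.
move=> ee e1 e2; rewrite mxtrace_idempotent //.
have /dvdnP[k ->] : (4 %| \rank e)%N; last by exists k; rewrite mulnC.
apply: (dvdn4_rank_quaternion _ _ _ _ _ e1 e2).
- by apply: mulmx_anti_sqr => //; apply: Qanti.
- by apply: mulmx_anti_sqr => //; apply: Qanti.
apply: anti_mxac.
  by apply: anti_mx_sym; apply: anti_mxca => //; apply: Qanti.
by apply: comm_mx_sym; apply: comm_mxaa; apply: Qanti; rewrite eq_sym.
Qed.

Definition half_proj (U : 'M[R]_n) := 2^-1 *: (1%:M + U).

Lemma half_proj_idem U : U *m U = 1%:M -> half_proj U *m half_proj U = half_proj U.
Proof.
move=> UU; rewrite -scalemxAl -scalemxAr scalerA mulmxDl mul1mx mulmxDr mulmx1 UU.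
rewrite (addrC U) -mulr2n -scaler_nat scalerA -mulrA mulVf ?mulr1 //.
by rewrite pnatr_eq0.
Qed.

Lemma half_proj_comm A U : comm_mx A U -> comm_mx A (half_proj U).
Proof.
by move=> AU; rewrite /comm_mx -scalemxAr -scalemxAl mulmxDr mulmxDl AU mulmx1 mul1mx.
Qed.

(** The projection onto the eigenspace of [Q q0] for 1 commutes with the quaternions and has trace
    [n / 2]. *)
Lemma clifford_dim : exists k : nat, n%:R = (8 * k)%:R :> R.
Proof.
have [n01 n02 n03 [n12 n13 n23]] := uniq4_neq q_uniq.
have [||k tre] := clifford_idempotent_trace _ (half_proj_idem _ (QQ q0)).
- apply: comm_mx_sym; apply: half_proj_comm; apply: comm_mx_sym.
  by apply: comm_mxaa; apply: Qanti.
- apply: comm_mx_sym; apply: half_proj_comm; apply: comm_mx_sym.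
  by apply: comm_mxaa; apply: Qanti.
exists k; move: tre; rewrite linearZ linearD /= mxtrace1 (mxtrace_clifford cQ q_uniq) addr0.
move/(congr1 ( *%R 2)); rewrite mulrA mulfV ?pnatr_eq0 // mul1r => ->.
by rewrite -natrM mulnA.
Qed.

(** Both eigenspaces of [w] are nonzero and have dimension divisible by 8, so in dimension 16 both
    have dimension 8. *)
Lemma clifford_volume5_trace (q4 : I) :
    let w := volume4 Q q0 q1 q2 q3 *m Q q4 in
    n = 16%N -> q4 \notin [:: q0; q1; q2; q3] -> w <> 1%:M -> w <> - 1%:M ->
  \tr w = 0.
Proof.
move=> w n16 q4n w1 wN1.
have [n01 n02 n03 [n12 n13 n23]] := uniq4_neq q_uniq.
have wcomm a : a \in [:: q0; q1; q2; q3] -> comm_mx (Q a) w.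
  move=> aq; apply: comm_mxaa; first exact: volume4_anti_in.
  by apply: Qanti; apply: contraNneq q4n => <-.
have ww : w *m w = 1%:M.
  have wT := volume4_comm_notin cQ _ q4n.
  by rewrite {2}/w -wT /w mulmxA -(mulmxA _ (Q q4) (Q q4)) QQ mulmx1 volume4_sqr.
have [in0 in1 in2 in3] : [/\ q0 \in [:: q0; q1; q2; q3], q1 \in [:: q0; q1; q2; q3],
    q2 \in [:: q0; q1; q2; q3] & q3 \in [:: q0; q1; q2; q3]].
  by rewrite !inE !eqxx !orbT.
have half_rank (s : R) : s ^+ 2 = 1 -> w <> - s%:M ->
    exists k : nat, n%:R + s * \tr w = (16 * k.+1)%:R.
  move=> s1 ws.
  (* The projection onto the vectors with [Q q0 = 1] and [w = s]. Its trace is a quarter of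
     [n + s * \tr w] and is divisible by 4. *)
  pose e := half_proj (Q q0) *m half_proj (s *: w).
  have sw2 : s *: w *m (s *: w) = 1%:M.
    by rewrite -scalemxAl -scalemxAr scalerA -expr2 s1 scale1r.
  have commw a : a \in [:: q0; q1; q2; q3] -> comm_mx (Q a) (half_proj (s *: w)).
    by move=> aq; apply: half_proj_comm; rewrite /comm_mx -scalemxAr -scalemxAl wcomm.
  have comm0 : comm_mx (half_proj (Q q0)) (half_proj (s *: w)).
    by apply: comm_mx_sym; apply: half_proj_comm; apply: comm_mx_sym; apply: commw.
  have ee : e *m e = e.
    rewrite {2}/e comm0 /e mulmxA -(mulmxA (half_proj _) (half_proj (s *: w))).
    by rewrite half_proj_idem // -mulmxA -comm0 mulmxA half_proj_idem.
  have eJ a : a \in [:: q1; q2; q3] -> q0 != a -> comm_mx e (Q q1 *m Q a).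
    move=> aq n0a; apply: comm_mx_sym; apply: comm_mxM.
      apply: half_proj_comm; apply: comm_mx_sym.
      by apply: comm_mxaa; apply: Qanti.
    apply: comm_mx_sym; apply: comm_mxM; apply: comm_mx_sym; apply: commw => //.
    by rewrite inE aq orbT.
  (* If [e] were 0, then [Q q0] would be -1 on the eigenspace of [w] for [s]. This space is stable
     under [Q q1], which anticommutes with [Q q0], so it would be zero and [w] would be [- s%:M]. *)
  have e_neq0 : e != 0.
    apply: contra_not_neq ws => e0.
    have : Q q1 *m half_proj (s *: w) = 0.
      have Q0h : Q q0 *m half_proj (s *: w) = - half_proj (s *: w).
        move/eqP: e0; rewrite /e {1}/half_proj -scalemxAl scaler_eq0 invr_eq0 pnatr_eq0 /=.
        by rewrite mulmxDl mul1mx addrC addr_eq0 => /eqP.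
      have Q1h := commw _ in1.
      have : Q q1 *m half_proj (s *: w) = - (Q q1 *m half_proj (s *: w)).
        rewrite -mulmxN -Q0h mulmxA (anti_mx_sym _ _ (Qanti _ _ n01)) mulNmx.
        by rewrite -mulmxA Q1h mulmxA Q0h mulNmx opprK.
      move/eqP; rewrite -addr_eq0 -mulr2n -scaler_nat scaler_eq0 pnatr_eq0 /=.
      by move/eqP.
    move/(congr1 (mulmx (Q q1))); rewrite mulmxA QQ mul1mx mulmx0 => /eqP.
    rewrite scaler_eq0 invr_eq0 pnatr_eq0 /= addrC addr_eq0 => /eqP sw.
    rewrite -[w]scale1r -s1 expr2 -scalerA sw scalerN.
    by rewrite scale_scalar_mx mulr1.
  have [||k tre] := clifford_idempotent_trace e ee.
  - by apply: eJ; rewrite // !inE eqxx ?orbT.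
  - by apply: eJ; rewrite // !inE eqxx ?orbT.
  have k_gt0 : (0 < k)%N.
    have := tre; rewrite mxtrace_idempotent // => /eqP.
    rewrite eqr_nat lt0n => /eqP rk; apply: contraNneq e_neq0 => k0.
    by rewrite -mxrank_eq0 rk k0.
  exists k.-1; rewrite prednK //.
  have trQw : \tr (Q q0 *m w) = 0.
    apply: (mxtrace_anti _ _ _ _ (QQ q1)); apply: anti_mxac; last exact: wcomm.
    by apply: Qanti; rewrite eq_sym.
  have : \tr e = 4^-1 * (n%:R + s * \tr w).
    rewrite /e /half_proj -scalemxAl -scalemxAr scalerA mulmxDl mul1mx mulmxDr mulmx1 -scalemxAr.
    rewrite linearZ !linearD !linearZ /= trQw mxtrace1 (mxtrace_clifford cQ q_uniq).
    by field.
  rewrite tre => /(congr1 ( *%R 4)); rewrite mulrA mulfV ?pnatr_eq0 // mul1r => <-.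
  by rewrite -natrM mulnA.
have [||k1 E1] := half_rank 1; rewrite ?expr1n //.
have [||k2 E2] := half_rank (-1); rewrite ?sqrrN ?expr1n //.
  by rewrite raddfN opprK.
have : (2 * n)%:R = (16 * (k1.+1 + k2.+1))%:R :> R.
  by rewrite mulnDr natrD -E1 -E2 natrM; ring.
move/eqP; rewrite eqr_nat => /eqP kE.
have k10 : k1 = 0%N by lia.
have n16R : n%:R = 16%:R :> R by rewrite n16.
by move: E1; rewrite k10 n16R mul1r muln1 => E1; apply: (addrI 16%:R); rewrite E1 addr0.
Qed.
End Ranks.

(** * Projection onto anticommuting matrices *)

Section AntiProjection.
Context {S : comPzRingType} {n : nat}.
Implicit Types (U V A B X : 'M[S]_n) (Us : seq 'M[S]_n).

Definition anti_part U B := B - U *m B *m U.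

(* Up to the factor [2 ^ size Us], the orthogonal projection onto the matrices
   anticommuting with all members of [Us]. *)
Definition anti_proj Us B := foldl (fun B U => anti_part U B) B Us.

Lemma anti_partZ U c B : anti_part U (c *: B) = c *: anti_part U B.
Proof. by rewrite /anti_part -scalemxAr -scalemxAl scalerBr. Qed.

Lemma anti_part_id U B : U *m U = 1%:M -> anti_part U (anti_part U B) = 2 *: anti_part U B.
Proof.
move=> UU; rewrite /anti_part mulmxBr mulmxBl !mulmxA UU mul1mx -!mulmxA UU mulmx1.
by rewrite opprB scaler_nat mulr2n.
Qed.

(** When [U] and [V] anticommute, exchanging them on both sides of [B] costs two signs, which
    cancel. *)
Lemma anti_part_comm U V B : U = V \/ anti_mx U V ->
  anti_part U (anti_part V B) = anti_part V (anti_part U B).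
Proof.
case=> [-> //|UV]; rewrite /anti_part !mulmxBr !mulmxBl.
have -> : U *m (V *m B *m V) *m U = V *m (U *m B *m U) *m V.
  rewrite !mulmxA UV !mulNmx -!mulmxA (anti_mx_sym _ _ UV) !mulmxN opprK.
  by [].
by rewrite !opprB addrACA [RHS]addrACA; congr (_ + _); apply: addrC.
Qed.

Lemma anti_part_adj U A B : \tr (anti_part U A *m B) = \tr (A *m anti_part U B).
Proof.
rewrite mulmxBl mulmxBr !linearB /=; congr (_ - _).
by rewrite -!mulmxA mxtrace_mulC !mulmxA.
Qed.

Lemma anti_part_tr U B : U^T = U -> B^T = B -> (anti_part U B)^T = anti_part U B.
Proof. by move=> Ut Bt; rewrite linearB /= !trmx_mul Ut Bt mulmxA. Qed.

Lemma anti_part_anti U B : U *m U = 1%:M -> anti_mx U B -> anti_part U B = 2 *: B.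
Proof.
by move=> UU UB; rewrite /anti_part conj_anti_mx // opprK scaler_nat mulr2n.
Qed.

Lemma anti_projZ Us c B : anti_proj Us (c *: B) = c *: anti_proj Us B.
Proof. by elim: Us B => //= U Us IH B; rewrite anti_partZ IH. Qed.

Lemma anti_proj_part Us U B : (forall V, V \in Us -> U = V \/ anti_mx U V) ->
  anti_proj Us (anti_part U B) = anti_part U (anti_proj Us B).
Proof.
elim: Us B => //= V Us IH B UUs; rewrite anti_part_comm; last first.
  by have [->|/anti_mx_sym] := UUs V (mem_head _ _); [left|right].
by rewrite IH // => W WUs; apply: UUs; rewrite inE WUs orbT.
Qed.

(** Taking adjoints reverses the order of the factors; their commutation restores it. *)
Lemma anti_proj_adj Us A B : (forall U V, U \in Us -> V \in Us -> U = V \/ anti_mx U V) ->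
  \tr (anti_proj Us A *m B) = \tr (A *m anti_proj Us B).
Proof.
elim: Us A B => //= U Us IH A B UUs.
have UsS : {subset Us <= U :: Us} by move=> V VUs; rewrite inE VUs orbT.
rewrite IH => [|V W /UsS VUs /UsS WUs]; last exact: UUs.
rewrite anti_part_adj anti_proj_part // => V /UsS VUs.
by apply: UUs; rewrite ?mem_head.
Qed.

Lemma anti_proj_tr Us B : (forall U, U \in Us -> U^T = U) -> B^T = B ->
  (anti_proj Us B)^T = anti_proj Us B.
Proof.
elim: Us B => //= U Us IH B UUs Bt; apply: IH => [V VUs|].
  by apply: UUs; rewrite inE VUs orbT.
by apply: anti_part_tr => //; apply: UUs; rewrite mem_head.
Qed.

Lemma anti_proj_anti Us B : (forall U, U \in Us -> U *m U = 1%:M /\ anti_mx U B) ->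
  anti_proj Us B = 2 ^+ size Us *: B.
Proof.
elim: Us B => /= [|U Us IH] B UUs; first by rewrite scale1r.
have [UU UB] := UUs U (mem_head _ _).
rewrite anti_part_anti // anti_projZ IH ?scalerA ?exprS // => V VUs.
by apply: UUs; rewrite inE VUs orbT.
Qed.

Lemma anti_proj_id Us B :
    (forall U, U \in Us -> U *m U = 1%:M) ->
    (forall U V, U \in Us -> V \in Us -> U = V \/ anti_mx U V) ->
  anti_proj Us (anti_proj Us B) = 2 ^+ size Us *: anti_proj Us B.
Proof.
elim: Us B => /= [|U Us IH] B UU UUs; first by rewrite scale1r.
have UsS : {subset Us <= U :: Us} by move=> V VUs; rewrite inE VUs orbT.
have UpU C : anti_proj Us (anti_part U C) = anti_part U (anti_proj Us C).
  by apply: anti_proj_part => V /UsS VUs; apply: UUs; rewrite ?mem_head.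
rewrite !UpU anti_part_id; last by rewrite UU ?mem_head.
rewrite IH => [|V /UsS VUs|V W /UsS VUs /UsS WUs]; [|exact: UU|exact: UUs].
by rewrite anti_partZ scalerA exprS.
Qed.

(** At X = x x^T this is the value <A x, x>. *)
Definition qform X A := \tr (A *m X).

Lemma qform_sqr (x : 'cV[S]_n) A (X := x *m x^T) :
  \tr (A *m X *m A^T *m X) = qform X A ^+ 2.
Proof.
have xAx : x^T *m A^T *m x = (qform X A)%:M.
  rewrite [LHS]mx11_scalar -trace_mx11 mxtrace_mulC mulmxA.
  by rewrite -mxtrace_tr trmx_mul trmxK trmx_mul trmxK.
have -> : A *m X *m A^T *m X = A *m x *m (x^T *m A^T *m x) *m x^T.
  by rewrite /X !mulmxA.
by rewrite xAx mul_mx_scalar -scalemxAl linearZ /= -mulmxA expr2.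
Qed.

End AntiProjection.

(** * The norm of the projection of a rank-one matrix *)

Section Expansion.
Context {S : idomainType} {n : nat} (two_neq0 : 2 != 0 :> S).
Context {I : finType} {Q : I -> 'M[S]_n} (cQ : clifford_family Q).
Context (x : 'cV[S]_n).
Let X := x *m x^T.
Implicit Types (A B U V : 'M[S]_n) (Us : seq 'M[S]_n).

Let Qt a : (Q a)^T = Q a. Proof. by case: cQ. Qed.
Let QQ a : Q a *m Q a = 1%:M. Proof. by case: cQ. Qed.
Let Qanti a b : a != b -> anti_mx (Q a) (Q b). Proof. by case: cQ => _ _; apply. Qed.

Let Xt : X^T = X. Proof. by rewrite trmx_mul trmxK. Qed.

Lemma double_eq0 (c : S) : c = - c -> c = 0.
Proof.
move/eqP; rewrite -addr_eq0 -mulr2n -mulr_natl mulf_eq0 (negPf two_neq0) /=.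
by move/eqP.
Qed.

Lemma qform_skew A : A^T = - A -> qform X A = 0.
Proof.
move=> At; apply: double_eq0.
by rewrite /qform -{1}mxtrace_tr trmx_mul Xt At mulmxN raddfN /= mxtrace_mulC.
Qed.

Lemma qform_mul2 a b : a != b -> qform X (Q a *m Q b) = 0.
Proof. by move=> ab; apply: qform_skew; apply: trmx_anti_mul => //; apply: Qanti. Qed.

(** Reversing three anticommuting factors takes three transpositions, so the product is skew. *)
Lemma qform_mul3 a b c : a != b -> a != c -> b != c ->
  qform X (Q a *m (Q b *m Q c)) = 0.
Proof.
move=> ab ac bc; apply: qform_skew; rewrite trmx_mul Qt.
rewrite trmx_anti_mul //; last exact: Qanti.
by rewrite mulNmx (comm_mxaa (Q a)) //; apply: Qanti.
Qed.

Lemma anti_projB Us A B : anti_proj Us (A - B) = anti_proj Us A - anti_proj Us B.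
Proof.
elim: Us A B => //= U Us IH A B; rewrite -IH; congr anti_proj.
rewrite /anti_part mulmxBr mulmxBl !opprB addrACA [RHS]addrACA; congr (_ + _).
by rewrite addrC.
Qed.

(** The matrix [V] accumulates the product of the generators already removed from [Us], which gives
    a recursion on the list. *)
Definition proj_norm Us V := \tr (anti_proj Us (V *m X *m V^T) *m X).

Lemma proj_norm_nil V : proj_norm [::] V = qform X V ^+ 2.
Proof. exact: qform_sqr. Qed.

Lemma proj_norm_cons U Us V : U^T = U ->
  proj_norm (U :: Us) V = proj_norm Us V - proj_norm Us (U *m V).
Proof.
move=> Ut; rewrite /proj_norm /= anti_projB mulmxBl linearB /=.
by rewrite trmx_mul Ut !mulmxA.
Qed.

(** The map [anti_proj] is self-adjoint and equals its own square up to the factor [2 ^+ size s]. *)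
Lemma proj_norm_sqr (s : seq I) :
  \sum_i \sum_j anti_proj (map Q s) X i j ^+ 2 =
  2 ^+ size s * proj_norm (map Q s) 1%:M.
Proof.
have Uinv U : U \in map Q s -> U *m U = 1%:M by case/mapP => a _ ->.
have Utr U : U \in map Q s -> U^T = U by case/mapP => a _ ->.
have Uanti U V : U \in map Q s -> V \in map Q s -> U = V \/ anti_mx U V.
  move=> /mapP[a _ ->] /mapP[b _ ->].
  by have [->|ab] := eqVneq a b; [left|right; apply: Qanti].
rewrite -mxtrace_tr_mul anti_proj_tr // -anti_proj_adj // anti_proj_id //.
by rewrite -scalemxAl linearZ size_map /proj_norm mul1mx trmx1 mulmx1.
Qed.

Let proj_normE := (mulmx1, proj_norm_cons, proj_norm_nil).

Lemma proj_norm2 a b : a != b -> proj_norm [:: Q b; Q a] 1%:M =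
  qform X 1%:M ^+ 2 - qform X (Q a) ^+ 2 - qform X (Q b) ^+ 2.
Proof.
by move=> ab; rewrite !proj_normE // qform_mul2 //; ring.
Qed.

Lemma proj_norm3 a b c : uniq [:: a; b; c] -> proj_norm [:: Q c; Q b; Q a] 1%:M =
  qform X 1%:M ^+ 2 - qform X (Q a) ^+ 2 - qform X (Q b) ^+ 2 - qform X (Q c) ^+ 2.
Proof.
rewrite /= !inE !negb_or andbT => /andP[/andP[ab ac] bc].
by rewrite !proj_normE // !qform_mul2 // !qform_mul3 //; ring.
Qed.

(** The recursion yields all sixteen subproducts with alternating sign. Those of two or three
    generators are skew and drop out; the product of all four is symmetric and enters with a plus
    sign. *)
Lemma proj_norm4 a b c d : uniq [:: a; b; c; d] ->
  proj_norm [:: Q d; Q c; Q b; Q a] 1%:M =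
  qform X 1%:M ^+ 2 - qform X (Q a) ^+ 2 - qform X (Q b) ^+ 2
    - qform X (Q c) ^+ 2 - qform X (Q d) ^+ 2 + qform X (volume4 Q a b c d) ^+ 2.
Proof.
rewrite /= !inE !negb_or andbT => /and3P[/and3P[ab ac ad] /andP[bc bd] cd].
by rewrite !proj_normE // !qform_mul2 // !qform_mul3 // /volume4 -mulmxA; ring.
Qed.

Lemma sqr_norm_sub A B : A^T = A -> B^T = B ->
  \sum_i \sum_j (A - B) i j ^+ 2 =
  \tr (A *m A) - 2 * \tr (A *m B) + \tr (B *m B).
Proof.
move=> At Bt; have trB C D : \tr (C - D) = \tr C - \tr D :> S := raddfB _ C D.
rewrite -mxtrace_tr_mul; have -> : (A - B)^T = A - B by rewrite linearB /= At Bt.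
by rewrite mulmxBl !mulmxBr !trB (mxtrace_mulC B A); ring.
Qed.

(* In dimension 16 the volume element and the remaining generators are
   orthogonal members of the range of the projection, so that they can be split
   off from it. *)
Lemma proj_residual (a b c d : I) (P : pred I) (Z : I -> 'M[S]_n)
    (s := [:: d; c; b; a])
    (Y := anti_proj (map Q s) X - \sum_(j | P j) qform X (Z j) *: Z j) :
    (forall j, P j -> (Z j)^T = Z j) ->
    (forall j t, P j -> t \in s -> anti_mx (Q t) (Z j)) ->
    (forall j k, P j -> P k -> \tr (Z j *m Z k) = 16 * (j == k)%:R) ->
  \sum_i \sum_j Y i j ^+ 2 =
  16 * (proj_norm (map Q s) 1%:M - \sum_(j | P j) qform X (Z j) ^+ 2).
Proof.
move=> Zt Zanti Ztr; set A := anti_proj _ _ in Y *.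
have At : A^T = A by apply: anti_proj_tr => // U /mapP[t _ ->].
have AA : \tr (A *m A) = 16 * proj_norm (map Q s) 1%:M.
  rewrite -{1}At mxtrace_tr_mul proj_norm_sqr; congr (_ * _); ring.
(* Self-adjointness moves the projection onto [Z j], which it multiplies by [2 ^+ 4]. *)
have AZ j : P j -> \tr (A *m Z j) = 16 * qform X (Z j).
  move=> Pj; rewrite anti_proj_adj; last first.
    move=> U V /mapP[t _ ->] /mapP[u _ ->].
    by have [->|tu] := eqVneq t u; [left|right; apply: Qanti].
  rewrite anti_proj_anti => [|U /mapP[t ts ->]]; last by split; [|apply: Zanti].
  rewrite -scalemxAr linearZ /= mxtrace_mulC; congr (_ * _); ring.
set W := \sum_(j | P j) _ in Y *.
have AW : \tr (A *m W) = 16 * \sum_(j | P j) qform X (Z j) ^+ 2.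
  rewrite mulmx_sumr linear_sum mulr_sumr; apply: eq_bigr => j Pj.
  by rewrite /= -scalemxAr linearZ /= AZ //; ring.
have WW : \tr (W *m W) = 16 * \sum_(j | P j) qform X (Z j) ^+ 2.
  rewrite {2}/W mulmx_sumr linear_sum mulr_sumr; apply: eq_bigr => j Pj /=.
  rewrite mulmx_suml linear_sum (bigD1 j) //= big1 => [|k /andP[Pk kj]].
    by rewrite addr0 -scalemxAr -scalemxAl !linearZ /= Ztr // eqxx mulr1; ring.
  by rewrite -scalemxAr -scalemxAl !linearZ /= Ztr // (negPf kj) !mulr0.
have Wt : W^T = W.
  by rewrite linear_sum; apply: eq_bigr => j Pj; rewrite linearZ /= Zt.
by rewrite sqr_norm_sub // AA AW WW; ring.
Qed.
End Expansion.

(** * Positivity and degree of the quartic *)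

(** With r = |x|^2 and W the sum of the <Q_a x, x> Q_a, the square of [W] is the scalar [s], and |(r
    - W) x|^2 expands to r (r^2 - s). *)
Lemma psd_clifford (R : realType) (n : nat) (I : finType) (Q : I -> 'M[R]_n) :
  clifford_family Q -> psd (quad_poly 1%:M ^+ 2 - \sum_a quad_poly (Q a) ^+ 2).
Proof.
move=> [Qt QQ Qa] x; pose v : 'cV[R]_n := \col_i x i; pose X := v *m v^T.
have quadE A : (quad_poly A).@[x] = qform X A.
  rewrite (meval_eq (v2 := v ^~ ord0)) => [|i]; last by rewrite mxE.
  rewrite quad_polyE -trace_mx11 -mxtrace_tr trmx_mul trmxK mxtrace_mulC.
  by rewrite /qform /X mulmxA.
rewrite mevalB (meval_sum _ (index_enum I)) expr2 mevalM -expr2 quadE.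
under eq_bigr do rewrite expr2 mevalM -expr2 quadE.
set r := qform X 1%:M; set s := \sum_a _.
have rE : r = \tr (v^T *m v) by rewrite /r /qform mul1mx mxtrace_mulC.
have [r0|r_neq0] := eqVneq r 0.
  have v0 : v = 0 by apply: mxtrace_tr_mul_eq0; rewrite -rE.
  have q0 A : qform X A = 0 by rewrite /qform /X v0 mul0mx mulmx0 raddf0.
  by rewrite /r /s q0 expr0n big1 ?subrr // => a _; rewrite q0 expr0n.
have r_gt0 : 0 < r by rewrite lt_def r_neq0 rE mxtrace_tr_mul_ge0.
pose W := \sum_a qform X (Q a) *: Q a.
have Wt : W^T = W by rewrite linear_sum; apply: eq_bigr => a _; rewrite linearZ /= Qt.
have qW : qform X W = s.
  rewrite /qform mulmx_suml linear_sum; apply: eq_bigr => a _ /=.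
  by rewrite -scalemxAl linearZ /= expr2.
have WW : W *m W = s%:M.
  (* Doubling lets each product [Q a *m Q b] meet [Q b *m Q a], so that the mixed terms cancel. *)
  have WW2 : 2 *: (W *m W) = 2 *: s%:M.
    have WWE : W *m W = \sum_a \sum_b (qform X (Q a) * qform X (Q b)) *: (Q a *m Q b).
      rewrite mulmx_suml; apply: eq_bigr => a _; rewrite mulmx_sumr.
      by apply: eq_bigr => b _; rewrite -scalemxAl -scalemxAr scalerA.
    rewrite scaler_nat mulr2n {1}WWE WWE [X in _ + X]exchange_big -big_split /=.
    rewrite scale_scalar_mx mulr_sumr raddf_sum; apply: eq_bigr => a _.
    rewrite -big_split (bigD1 a) //= big1 ?addr0 => [|b ba].
      by rewrite QQ -mulr2n -scaler_nat scalerA scale_scalar_mx mulr1 expr2.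
    by rewrite (Qa b a) // scalerN mulrC subrr.
  by have := WW2 => /(scalerI (_ : 2 != 0 :> R)); apply; rewrite pnatr_eq0.
pose M := r%:M - W.
have : 0 <= \tr ((M *m v)^T *m (M *m v)) by apply: mxtrace_tr_mul_ge0.
have -> : \tr ((M *m v)^T *m (M *m v)) = qform X (M *m M).
  have Mt : M^T = M by rewrite linearB /= tr_scalar_mx Wt.
  by rewrite trmx_mul Mt -!mulmxA mxtrace_mulC /qform /X !mulmxA.
have -> : M *m M = (r ^+ 2 + s) *: 1%:M - (2 * r) *: W.
  rewrite mulmxBl !mulmxBr WW !mul_scalar_mx !mul_mx_scalar !scale_scalar_mx.
  by apply/matrixP => i j; rewrite !mxE; case: (i == j) => /=; ring.
rewrite /qform mulmxBl -!scalemxAl !linearB /= !linearZ /= -/(qform X 1%:M) -/r.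
rewrite -/(qform X W) qW.
have -> : (r ^+ 2 + s) * r - 2 * r * s = r * (r ^+ 2 - s) by ring.
by rewrite pmulr_rge0.
Qed.

Lemma quad_poly_homog (R : realType) (n : nat) (A : 'M[R]_n) :
  quad_poly A \is 2.-homog.
Proof.
apply: rpred_sum => i _; apply: (@dhomogM _ _ _ 1 _ 1); last by rewrite dhomogX /= mdeg1.
by apply: rpred_sum => j _; apply: dhomogZ; rewrite dhomogX /= mdeg1.
Qed.

Lemma quartic_homog (R : realType) (n : nat) (I : finType) (Q : I -> 'M[R]_n) :
  quad_poly 1%:M ^+ 2 - \sum_a quad_poly (Q a) ^+ 2 \is 4.-homog.
Proof.
have sq A : quad_poly A ^+ 2 \is 4.-homog by apply: (dhomogMn 2 (quad_poly_homog _ _ A)).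
by rewrite rpredB ?sq ?rpred_sum // => a _; apply: sq.
Qed.

(** The constant is absorbed into the squares through a real square root of its inverse. *)
Lemma sos_of_entries (R : realType) (n k c : nat) (p : {mpoly R[n]})
    (Y : 'M[{mpoly R[n]}]_k) :
  (0 < c)%N -> \sum_i \sum_j Y i j ^+ 2 = c%:R * p -> sos p.
Proof.
move=> c_gt0 YE; pose r : R := Num.sqrt c%:R^-1.
exists [seq r *: Y i j | i <- enum 'I_k, j <- enum 'I_k].
rewrite big_allpairs_dep.
under eq_bigr do under eq_bigr do rewrite exprZn sqr_sqrtr ?invr_ge0 ?ler0n //.
under eq_bigr do rewrite -scaler_sumr big_enum /=.
rewrite -scaler_sumr big_enum /= YE mulr_natl -scaler_nat scalerA mulVf ?scale1r //.
by rewrite pnatr_eq0 -lt0n.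
Qed.

(** * Explicit sums of squares, at the point whose coordinates are the indeterminates *)

Section GenericPoint.
Context {R : realType} {n : nat}.
Local Notation S := {mpoly R[n]}.
Local Notation polymx A := (map_mx (@mpolyC n R) A).
Let x : 'cV[S]_n := \col_i 'X_i.
Let X := x *m x^T.

Lemma quad_qform (A : 'M[R]_n) : qform X (polymx A) = quad_poly A.
Proof.
apply: eq_bigr => i _; rewrite mulmxA mxE big_ord1 !mxE; congr (_ * _).
by apply: eq_bigr => j _; rewrite !mxE mul_mpolyC.
Qed.

Lemma quad_qform1 : qform X 1%:M = quad_poly 1%:M.
Proof. by rewrite -quad_qform map_mx1. Qed.

Lemma mpoly_two_neq0 : 2 != 0 :> S.
Proof. by rewrite -(mpolyC_nat _ _ 2) mpolyC_eq0 pnatr_eq0. Qed.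

Lemma polymx_anti (A B : 'M[R]_n) : anti_mx A B -> anti_mx (polymx A) (polymx B).
Proof. by move=> AB; rewrite /anti_mx -!map_mxM AB raddfN. Qed.

Lemma clifford_family_polymx (I : finType) (Q : I -> 'M[R]_n) :
  clifford_family Q -> clifford_family (fun a => polymx (Q a)).
Proof.
move=> [Qt QQ Qa]; split=> [a|a|a b /Qa]; last exact: polymx_anti.
- by rewrite map_trmx Qt.
- by rewrite -map_mxM QQ map_mx1.
Qed.

(** The squares are the entries of the projected x x^T; their sum is [2 ^+ 2] times the quartic. *)
Lemma sos_clifford2 (Q : 'I_2 -> 'M[R]_n) : clifford_family Q ->
  sos (quad_poly 1%:M ^+ 2 - \sum_a quad_poly (Q a) ^+ 2).
Proof.
move=> cQ; have cQ' := clifford_family_polymx _ _ cQ.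
pose a : 'I_2 := ord0; pose b : 'I_2 := lift ord0 ord0.
apply: (@sos_of_entries _ _ _ 4 _ (anti_proj [seq polymx (Q i) | i <- [:: b; a]] X)) => //.
rewrite (proj_norm_sqr cQ') /= (proj_norm2 mpoly_two_neq0 cQ') //.
by rewrite quad_qform1 !quad_qform !big_ord_recl big_ord0 /=; ring.
Qed.

Lemma sos_clifford3 (Q : 'I_3 -> 'M[R]_n) : clifford_family Q ->
  sos (quad_poly 1%:M ^+ 2 - \sum_a quad_poly (Q a) ^+ 2).
Proof.
move=> cQ; have cQ' := clifford_family_polymx _ _ cQ.
pose a : 'I_3 := ord0; pose b : 'I_3 := lift ord0 ord0.
pose c : 'I_3 := lift ord0 (lift ord0 ord0).
apply: (@sos_of_entries _ _ _ 8 _ (anti_proj [seq polymx (Q i) | i <- [:: c; b; a]] X)) => //.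
rewrite (proj_norm_sqr cQ') /= (proj_norm3 mpoly_two_neq0 cQ') //.
by rewrite quad_qform1 !quad_qform !big_ord_recl big_ord0 /=; ring.
Qed.

(** The trace condition makes the volume element orthogonal to the other generators. Splitting all
    of these off the projection cancels the extra volume term of [proj_norm4] and supplies the
    missing generators. *)
Lemma sos_clifford_dim16 (I : finType) (Q : I -> 'M[R]_n) (q0 q1 q2 q3 : I) :
    clifford_family Q -> n = 16%N -> uniq [:: q0; q1; q2; q3] ->
    (forall a, a \notin [:: q0; q1; q2; q3] ->
       \tr (Q a *m volume4 Q q0 q1 q2 q3) = 0) ->
  sos (quad_poly 1%:M ^+ 2 - \sum_a quad_poly (Q a) ^+ 2).
Proof.
move=> cQ n16 q_uniq trT; have cQ' := clifford_family_polymx _ _ cQ.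
have [Qt QQ Qa] := cQ.
have n16R : n%:R = 16 :> R by rewrite n16.
set T := volume4 _ _ _ _ _ in trT.
have volE : volume4 (fun a => polymx (Q a)) q0 q1 q2 q3 = polymx T.
  by rewrite /volume4 /T !map_mxM.
(* The slot of [q0] is reused for the volume element. *)
pose p : pred I := [pred j | j \notin [:: q1; q2; q3]].
pose Z j := if j == q0 then T else Q j.
have pq j : p j -> j != q0 -> j \notin [:: q0; q1; q2; q3].
  by move=> pj jq0; rewrite inE negb_or jq0.
have Zt j : p j -> (Z j)^T = Z j.
  by rewrite /Z; case: eqP => // _ _; apply: volume4_tr.
have mem_rot t : t \in [:: q3; q2; q1; q0] = (t \in [:: q0; q1; q2; q3]).
  by rewrite -(mem_rev [:: q0; q1; q2; q3]).
have Zanti j t : p j -> t \in [:: q3; q2; q1; q0] -> anti_mx (Q t) (Z j).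
  rewrite mem_rot /Z => pj tq; case: eqP => [_|/eqP jq0]; first exact: volume4_anti_in.
  by apply: Qa; apply: contraNneq (pq _ pj jq0) => <-.
have ZZ j : p j -> Z j *m Z j = 1%:M.
  by rewrite /Z; case: eqP => // _ _; apply: volume4_sqr.
have Ztr j k : p j -> p k -> \tr (Z j *m Z k) = 16 * (j == k)%:R.
  move=> pj pk; have [<-|jk] := eqVneq j k.
    by rewrite ZZ // mxtrace1 mulr1 n16R.
  rewrite mulr0 /Z; have [jq0|jq0] := eqVneq j q0.
    have kq0 : k != q0 by rewrite -jq0 eq_sym.
    by rewrite (negPf kq0) mxtrace_mulC trT ?pq.
  case: eqP => [_|_]; first by rewrite trT ?pq.
  by apply: mxtrace_mul_anti; apply: Qa.
apply: (@sos_of_entries _ _ _ 16 _ _ isT (etrans (proj_residual cQ' x q0 q1 q2 q3 p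
  (fun j => polymx (Z j)) _ _ _) _)).
- by move=> j pj; rewrite map_trmx Zt.
- by move=> j t pj tq; apply: polymx_anti; apply: Zanti.
- by move=> j k pj pk; rewrite -map_mxM trace_map_mx Ztr // rmorphM /= !rmorph_nat.
rewrite (proj_norm4 mpoly_two_neq0 cQ' _ _ _ _ _ q_uniq) volE quad_qform1 !quad_qform.
congr (_ * _); under [X in _ - X = _]eq_bigr do rewrite quad_qform.
have pq0 : p q0 by move: q_uniq => /= /andP[].
rewrite (bigD1 q0) //= {1}/Z eqxx [in RHS](bigID (mem [:: q0; q1; q2; q3])) /=.
rewrite -(big_uniq _ q_uniq) !big_cons big_nil.
have -> : \sum_(i | p i && (i != q0)) quad_poly (Z i) ^+ 2 =
    \sum_(i | i \notin [:: q0; q1; q2; q3]) quad_poly (Q i) ^+ 2.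
  apply: eq_big => [i|i /andP[_ iq0]]; last by rewrite /Z (negPf iq0).
  by rewrite /p /= [in RHS]inE negb_or andbC.
by rewrite /=; ring.
Qed.
End GenericPoint.

(** * The classification *)

Section FirstFour.
Context {m : nat} (m_ge3 : (3 <= m)%N).

Definition first4 : seq 'I_m.+1 := [:: inord 0; inord 1; inord 2; inord 3].

Lemma val_first4 : map val first4 = iota 0 4.
Proof. by rewrite /= !inordK //; lia. Qed.

Lemma first4_uniq : uniq first4.
Proof. by rewrite -(map_inj_uniq val_inj) val_first4 iota_uniq. Qed.

Lemma mem_first4 a : (a \in first4) = (a < 4)%N.
Proof. by rewrite -(mem_map val_inj) val_first4 mem_iota. Qed.
End FirstFour.

Lemma clifford_prod5 (R : realType) (l m : nat) (P : 'I_m.+1 -> 'M[R]_(2 * l)) :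
  m = 4%N ->
  clifford_prod P = volume4 P (inord 0) (inord 1) (inord 2) (inord 3) *m P (inord 4).
Proof.
move=> m4; subst m; rewrite /clifford_prod !big_ord_recl big_ord0 mulmx1 !mulmxA /volume4.
rewrite !mulmxA.
by congr (P _ *m P _ *m P _ *m P _ *m P _); apply: val_inj; rewrite /= inordK.
Qed.

Section Classification.
Context {R : realType} {l m : nat} {P : 'I_m.+1 -> 'M[R]_(2 * l)}.
Context (cP : clifford_family P) (hm : (3 <= m)%N) (hl : (1 <= l - m - 1)%N).
Let T := volume4 P (inord 0) (inord 1) (inord 2) (inord 3).

Lemma clifford_dvdn4 : exists k, l = (4 * k)%N.
Proof.
have [k /eqP] := clifford_dim cP (first4_uniq hm).
by rewrite eqr_nat => /eqP E; exists k; lia.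
Qed.

Lemma sos_necessary : sos (quad_poly 1%:M ^+ 2 - \sum_a quad_poly (P a) ^+ 2) ->
  l = 8%N /\ (m = 4%N -> ~ definite P).
Proof.
have [Pt PP Pa] := cP.
move=> /(sos_quartic_gram _ _ Pt)[As Ast gram].
have q_uniq := first4_uniq hm.
have gramT := gram_volume4 cP q_uniq _ Ast gram.
have [k lk] := clifford_dvdn4.
have n16 : (2 * l <= 16)%N.
  rewrite -(ler_nat R) -subr_ge0 -(pmulr_rge0 _ (_ : 0 < (2 * l)%:R)); last first.
    by rewrite ltr0n; lia.
  have -> : (2 * l)%:R * (16 - (2 * l)%:R) = \sum_(A <- As) \tr (A *m T) ^+ 2 +
      \sum_(a | a \notin first4) \tr (P a *m T) ^+ 2 :> R by rewrite gramT subrK.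
  by rewrite addr_ge0 ?sumr_ge0 // => *; rewrite sqr_ge0.
(* Besides [l <= 8] and 4 dividing [l], the hypotheses give [l >= m + 2 >= 5]. *)
have l8 : l = 8%N by lia.
have nR : (2 * l)%:R = 16 :> R by rewrite l8.
split=> // m4 [_ defP].
pose a4 : 'I_m.+1 := inord 4.
have a4n : a4 \notin first4 by rewrite (mem_first4 hm) inordK ?m4.
have a4T : comm_mx (P a4) T := volume4_comm_notin cP _ a4n.
(* [P a4] anticommutes with [A] and commutes with [T], hence anticommutes with [A *m T]. *)
have A0 A : A \in As -> \tr (A *m T) = 0.
  move=> AAs; apply: (mxtrace_anti _ _ _ _ (PP a4)); apply: anti_mxac => //.
  exact: (gram_anti_clifford _ _ _ cP Ast gram).
have : \sum_(a | a \notin first4) \tr (P a *m T) ^+ 2 = 0.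
  have := gramT; rewrite big_seq big1 => [|A /A0 ->]; last by rewrite expr0n.
  by rewrite nR subrr mulr0 sub0r => /eqP; rewrite eq_sym oppr_eq0 => /eqP.
move/eqP; rewrite psumr_eq0 => [|a _]; last exact: sqr_ge0.
move=> /allP/(_ a4 (mem_index_enum _)); rewrite a4n sqrf_eq0 mxtrace_mulC -clifford_prod5 //.
(* For a definite system the trace just shown to be zero would be 16 or -16. *)
by case: defP => ->; rewrite ?raddfN /= mxtrace1 nR ?oppr_eq0 pnatr_eq0.
Qed.

Lemma sos_sufficient : l = 8%N -> (m = 4%N -> ~ definite P) ->
  sos (quad_poly 1%:M ^+ 2 - \sum_a quad_poly (P a) ^+ 2).
Proof.
move=> l8 ndef; have [Pt PP Pa] := cP; have q_uniq := first4_uniq hm.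
apply: (sos_clifford_dim16 _ _ (inord 0) (inord 1) (inord 2) (inord 3)) => //.
  by rewrite l8.
move=> a an; have [m4|m_neq4] := eqVneq m 4%N.
  have a4 : a = inord 4.
    apply: val_inj; rewrite /= inordK ?m4 //.
    by move: an (ltn_ord a); rewrite (mem_first4 hm); lia.
  rewrite a4 in an *; rewrite mxtrace_mulC.
  apply: (clifford_volume5_trace cP q_uniq _ _ an); first by rewrite l8.
    by rewrite -clifford_prod5 // => E; apply: (ndef m4); split; [lia|left].
  by rewrite -clifford_prod5 // => E; apply: (ndef m4); split; [lia|right].
(* An index [a] above 3 with [m] not 4 forces [m >= 5], which leaves a second generator outside [T].
   It commutes with [T] and anticommutes with [P a], so the trace vanishes. *)
have [b bn ba] : exists2 b, b \notin first4 & b != a.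
  move: an (ltn_ord a); rewrite (mem_first4 hm) => a4 am.
  have [a4E|] := eqVneq (a : nat) 4%N.
    exists (inord 5); first by rewrite (mem_first4 hm) inordK //; lia.
    by rewrite -val_eqE /= inordK; lia.
  exists (inord 4); first by rewrite (mem_first4 hm) inordK //; lia.
  by rewrite -val_eqE /= inordK; lia.
apply: (mxtrace_anti _ _ _ _ (PP b)); apply: anti_mxac; first exact: Pa.
exact: volume4_comm_notin.
Qed.
End Classification.

Lemma GF_quad (R : realType) (l m : nat) (P : 'I_m.+1 -> 'M[R]_(2 * l)) :
  GF P = quad_poly 1%:M ^+ 2 - \sum_a quad_poly (P a) ^+ 2.
Proof. by rewrite GF_E sqnorm_quad. Qed.

Theorem theorem4p1 (R : realType) (l m : nat) (P : 'I_m.+1 -> 'M[R]_(2 * l))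
    (hm : (1 <= m)%N) (hl : (1 <= l - m - 1)%N) (hP : clifford_system P) :
  [/\ GF P \is 4.-homog,
      psd (GF P)
    & sos (GF P) <->
      (m = 1%N \/ m = 2%N \/
       multiplicities l m = (5%N, 2%N) \/
       multiplicities l m = (6%N, 1%N) \/
       multiplicities l m = (3%N, 4%N) \/
       (multiplicities l m = (4%N, 3%N) /\ indefinite P))].
Proof.
have cP := clifford_system_family hP; rewrite GF_quad.
split; [exact: quartic_homog|exact: psd_clifford|].
have [m_ge3|m_lt3] := leqP 3 m; last first.
  have [m1|m2] : m = 1%N \/ m = 2%N by lia.
    by split=> [_|_]; [left|subst m; exact: sos_clifford2].
  by split=> [_|_]; [right; left|subst m; exact: sos_clifford3].
split=> [/(sos_necessary cP m_ge3 hl)[l8 ndef]|mult].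
  (* With [l = 8], positivity of [l - m - 1] bounds [m] by 6. *)
  have [m3|[m4|[m5|m6]]] : m = 3%N \/ m = 4%N \/ m = 5%N \/ m = 6%N by lia.
  - by do 4!right; left; rewrite /multiplicities m3 l8.
  - do 5!right; split; first by rewrite /multiplicities m4 l8.
    by split; [rewrite m4|exact: ndef].
  - by do 2!right; left; rewrite /multiplicities m5 l8.
  by do 3!right; left; rewrite /multiplicities m6 l8.
(* In the remaining cases the two multiplicities add up to [l - 1 = 7]. *)
have [l8 ndef] : l = 8%N /\ (m = 4%N -> ~ definite P).
  move: mult; rewrite /multiplicities.
  by move=> [|[|[[] ? ?|[[] ? ?|[[] ? ?|[[] ? ? [_ ?]]]]]]]; split;
    (lia || by [] || by move=> ?; lia).
exact: sos_sufficient.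
Qed.
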